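(* Let $k\ge 0$, $1\le p<+\infty$ and $f\in L^p(\mathbb{R},|x|^{2k}dx)$. Then for all $t>0$ and $x\in\mathbb{R}$ the heat-diffusion integral $G_k(f)(t,x)=\sum_{n=0}^{+\infty}e^{-t(2n+2k+1)}a_n^k(f)h_n^k(x)$ has the integral representation $$G_k(f)(t,x)=\int_{\mathbb{R}}P_k(t,x,y)f(y)|y|^{2k}\,dy,$$ where $$P_k(t,x,y)=\sum_{n=0}^{+\infty}e^{-t(2n+2k+1)}h_n^k(x)h_n^k(y).$$
   Context: Dunkl--Hermite functions: for $n\ge 0$, $h_n^k(x)=e^{-x^2/2}H_n^k(x)$, where $$H_{2n}^k(x)=(-1)^n\sqrt{\tfrac{n!}{\Gamma(n+k+\frac12)}}\,L_n^{k-\frac12}(x^2),\qquad H_{2n+1}^k(x)=(-1)^n\sqrt{\tfrac{n!}{\Gamma(n+k+\frac32)}}\,x\,L_n^{k+\frac12}(x^2),$$ and $L_n^\alpha(x)=\frac{1}{n!}x^{-\alpha}e^x\frac{d^n}{dx^n}(x^{n+\alpha}e^{-x})$ are the Laguerre polynomials. $L^p(\mathbb{R},|x|^{2k}dx)$ is the space of measurable $f$ on $\mathbb{R}$ with $\|f\|_{k,p}=\left(\int_{\mathbb{R}}|f(x)|^p|x|^{2k}dx\right)^{1/p}<+\infty$. The coefficients are $a_n^k(f)=\int_{\mathbb{R}}f(t)h_n^k(t)|t|^{2k}dt$. *)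

(* Defs.v *)
From HB Require Import structures.
From mathcomp Require Import all_boot all_order all_algebra.
From mathcomp Require Import all_classical all_reals all_analysis.
From mathcomp Require Import ring.

Set Implicit Arguments.
Unset Strict Implicit.
Unset Printing Implicit Defensive.

Import Order.TTheory GRing.Theory Num.Theory.
Import numFieldNormedType.Exports.

Local Open Scope classical_set_scope.
Local Open Scope ring_scope.

Section Laguerre.
Context {R : realType}.
Implicit Types (b x alpha : R) (n : nat) (q : {poly R}).

Definition laguerre_rodrigues n alpha x : R :=
  (n`!%:R)^-1 * x `^ (- alpha) * expR x *
  derive1n n (fun y => y `^ (n%:R + alpha) * expR (- y)) x.

(* The Rodrigues formula only makes sense for x > 0, whereas L_n^alpha is also
   evaluated at 0: L_n^alpha is the polynomial that agrees with the formula on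
   the open half-line. There is one by laguerreE, and only one by
   poly_eq_pos. *)
Definition laguerre n alpha : {poly R} :=
  xget 0 [set q : {poly R} |
          forall x, 0 < x -> q.[x] = laguerre_rodrigues n alpha x].

Lemma poly_eq_pos (q1 q2 : {poly R}) :
  (forall x, 0 < x -> q1.[x] = q2.[x]) -> q1 = q2.
Proof.
move=> q12; apply/eqP; rewrite -subr_eq0; apply/eqP.
pose s := [seq (i.+1%:R : R) | i <- iota 0 (size (q1 - q2))].
apply: (@roots_geq_poly_eq0 _ _ s).
- apply/allP => _ /mapP[i _ ->].
  by rewrite rootE hornerD hornerN q12 ?subrr.
- rewrite map_inj_uniq ?iota_uniq// => i j /eqP.
  by rewrite eqr_nat => /eqP[].
- by rewrite size_map size_iota.
Qed.

Let is_derive_powR_expRN_horner b q x : 0 < x ->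
  is_derive x 1 (fun y => y `^ b * expR (- y) * q.[y])
    (x `^ (b - 1) * expR (- x) * (b *: q + 'X * q^`() - 'X * q).[x]).
Proof.
move=> x0.
have dp : is_derive x 1 ((@powR R)^~ b) (b * x `^ (b - 1)).
  exact: is_derive1_powR.
have de : is_derive x 1 (fun y : R => expR (- y)) (- expR (- x)).
  have h : is_derive x 1 (-%R : R -> R) (-1) by apply: is_deriveN.
  have := @is_derive1_comp _ expR -%R x _ _ (is_derive_expR (- x)) h.
  by rewrite mulrN1.
have dq : is_derive x 1 (horner q) (q^`()).[x] by exact: is_derive_poly.
have d1 := is_deriveM dp de.
have d2 := is_deriveM d1 dq.
apply: (is_derive_eq d2).
transitivity (x `^ b * expR (- x) * (q^`()).[x] +
  q.[x] * (x `^ b * - expR (- x) + expR (- x) * (b * x `^ (b - 1)))) => //.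
rewrite hornerD hornerN hornerD !hornerM hornerZ hornerX.
have -> : x `^ b = x `^ (b - 1) * x.
  by rewrite -{3}(powRr1 (ltW x0)) -powRD ?subrK// (gt_eqF x0) implybT.
by ring.
Qed.

Lemma laguerreE n alpha x :
  0 < x -> (laguerre n alpha).[x] = laguerre_rodrigues n alpha x.
Proof.
move: x; rewrite /laguerre.
apply: (@xgetPex _ 0 [set q : {poly R} |
  forall x, 0 < x -> q.[x] = laguerre_rodrigues n alpha x]) => /=.
suff [q qE] : exists q : {poly R}, forall x, 0 < x ->
    derive1n n (fun y => y `^ (n%:R + alpha) * expR (- y)) x =
    x `^ alpha * expR (- x) * q.[x].
  exists ((n`!%:R)^-1 *: q) => x x0; rewrite /laguerre_rodrigues qE// hornerZ.
  rewrite powRN expRN.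
  have : x `^ alpha != 0 by rewrite gt_eqF// powR_gt0.
  have : expR x != 0 by rewrite gt_eqF// expR_gt0.
  have : n`!%:R != 0 :> R by rewrite pnatr_eq0 -lt0n fact_gt0.
  by move=> ? ? ?; field; apply/and3P.
pose g : R -> R := fun y => y `^ (n%:R + alpha) * expR (- y).
suff H m : exists q : {poly R}, forall x, 0 < x ->
    derive1n m g x = x `^ (n%:R + alpha - m%:R) * expR (- x) * q.[x].
  have [q qE] := H n; exists q => x x0; rewrite -/g qE//.
  by rewrite addrAC subrr add0r.
elim: m => [|m [q IH]].
  by exists 1 => x x0; rewrite hornerE mulr1 subr0.
pose b := n%:R + alpha - m%:R.
exists (b *: q + 'X * q^`() - 'X * q) => x x0.
have -> : n%:R + alpha - m.+1%:R = b - 1 by rewrite /b -natr1; ring.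
rewrite derive1nS derive1E.
have /@derive_val <- := is_derive_powR_expRN_horner b q x0.
apply: near_eq_derive.
by near do apply: IH; exact: lt_nbhsr.
Unshelve. all: by end_near. Qed.

End Laguerre.

Section DunklHermite.
Context {R : realType}.
Implicit Types (k p t x y z : R) (n : nat) (f : R -> R).

Local Notation mu := (@lebesgue_measure R).

Definition Gamma z : R :=
  \int[mu]_(x in `]0, +oo[) (x `^ (z - 1) * expR (- x)).

Definition dunkl_hermite_poly k n x : R :=
  let m := n./2 in
  if odd n then
    (-1) ^+ m * Num.sqrt (m`!%:R / Gamma (m%:R + k + 3 / 2)) *
    x * (laguerre m (k + 1 / 2)).[x ^+ 2]
  else
    (-1) ^+ m * Num.sqrt (m`!%:R / Gamma (m%:R + k + 1 / 2)) *
    (laguerre m (k - 1 / 2)).[x ^+ 2].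

Definition dunkl_hermite k n x : R :=
  expR (- (x ^+ 2 / 2)) * dunkl_hermite_poly k n x.

(* Density |x|^{2k}; since 0 `^ 0 = 1, it is constantly 1 when k = 0. *)
Definition dunkl_weight k x : R := `|x| `^ (2 * k).

Definition dunkl_Lnorm k p f : \bar R :=
  ((\int[mu]_x (`|f x| `^ p * dunkl_weight k x)%:E) `^ p^-1)%E.

Definition dunkl_Lp k p : set (R -> R) :=
  [set f | measurable_fun setT f /\ (dunkl_Lnorm k p f < +oo)%E].

Definition dunkl_hermite_coef k f n : R :=
  \int[mu]_y (f y * dunkl_hermite k n y * dunkl_weight k y).

Definition dunkl_heat_term k f t x n : R :=
  expR (- t * (2 * n%:R + 2 * k + 1)) *
  dunkl_hermite_coef k f n * dunkl_hermite k n x.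

Definition dunkl_heat k f t x : R :=
  limn (series (dunkl_heat_term k f t x)).

Definition dunkl_kernel_term k t x y n : R :=
  expR (- t * (2 * n%:R + 2 * k + 1)) *
  dunkl_hermite k n x * dunkl_hermite k n y.

Definition dunkl_kernel k t x y : R :=
  limn (series (dunkl_kernel_term k t x y)).

End DunklHermite.

(* Main.v *)
Require Import Defs.
From HB Require Import structures.
From mathcomp Require Import all_boot all_order all_algebra.
From mathcomp Require Import all_classical all_reals all_analysis.
From mathcomp Require Import measurable_realfun.
From mathcomp Require Import ring lra.

Import Order.TTheory GRing.Theory Num.Theory.
Import numFieldNormedType.Exports.

Local Open Scope classical_set_scope.
Local Open Scope ring_scope.

(** The identity is an exchange of sum and integral, so everything rests on a
bound for the Dunkl-Hermite functions whose growth in n is slower than every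
exponential and which decays in the variable: for every s > 0 there are C and
d > 0 with
  |h_n(x)| <= C e^(s n) e^(- d x^2)      ([dunkl_hermite_bound]).
With s = t / 2 the factor e^(- 2 t n) of the heat semigroup absorbs both
copies of e^(s n) and leaves a geometric factor e^(- t n). For f in L^p the
function e^(- d y^2) |f(y)| |y|^(2k) is integrable, because e |f| <= |f|^p + e
whenever 0 <= e <= 1 and p >= 1 ([integrable_Lp_gaussian]); this replaces
Hoelder's inequality and treats p = 1 and p > 1 alike. Dominated convergence of
the partial sums then gives all the claims at once
([Rintegral_geometric_dominated], [heat_kernel_representation]).

For the bound, one needs |L_n^a(u)| <= poly(n) r^(- n) e^(c u) with
c = r / (1 + r) and any r < 1: since c < 1/2, the Gaussian e^(- u / 2) with
u = x^2 wins. In terms of the generating function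
F(z, u) = (1 - z)^(- a - 1) e^(- u z / (1 - z)) this is Cauchy's estimate on
the circle |z| = r, where Re (- z / (1 - z)) <= r / (1 + r). The proof here is
a real-variable version of it: the energy
  E(u) = sum_(n < N) (r^n L_n^a(u))^2,
which Parseval's formula turns into a mean square of F over that circle when
N is infinite, satisfies the differential inequality E' <= 2 c E
([deriv_laguerre_energy]). It holds for every finite N, because
L_(n+1)' = L_n' - L_n expresses L_n' by the lower L_j alone. Hence
E(u) <= e^(2 c u) E(0), and E(0) grows at most polynomially in N because
L_n(0) = (1 + a) (1 + a / 2) ... (1 + a / n).

The normalisation n! / Gamma(n + b) grows at most polynomially, as one sees by
integrating only over [n + 1, n + 2] ([fact_div_Gamma_bound]). *)

(** * Laguerre polynomials from the Rodrigues formula *)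

Section Rodrigues.
Context {R : realType}.
Implicit Types (a b x u : R) (m n : nat).

(** The m-th derivative of y^b e^(- y) is y^(b - m) e^(- y) times this polynomial.
All values of b are kept, since the recurrences below relate b to b + 1. *)
Fixpoint rodrigues_poly b m : {poly R} :=
  if m is m'.+1 then
    let q := rodrigues_poly b m' in (b - m'%:R)%:P * q + 'X * q^`() - 'X * q
  else 1.

Lemma deriv_rodrigues_poly b m :
  (rodrigues_poly b m.+1)^`() = - (m.+1%:R * rodrigues_poly b m).
Proof.
elim: m => [|m IH].
  rewrite /= !(derivB, derivD, derivM) derivC derivX -polyC1 derivC.
  by rewrite deriv0; ring.
have q1E : rodrigues_poly b m.+1 = (b - m%:R)%:P * rodrigues_poly b m +
  'X * (rodrigues_poly b m)^`() - 'X * rodrigues_poly b m by [].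
have -> : rodrigues_poly b m.+2 = (b - m.+1%:R)%:P * rodrigues_poly b m.+1 +
  'X * (rodrigues_poly b m.+1)^`() - 'X * rodrigues_poly b m.+1 by [].
move: (rodrigues_poly b m.+1) q1E IH => q1 q1E IH.
rewrite !(derivB, derivD, derivM) derivC derivX IH.
rewrite -!polyC_natr derivN derivM derivC.
move: (rodrigues_poly b m) q1E => q; rewrite -!natr1 !polyCB !polyCD => q1E.
transitivity (- (m%:R%:P + 1) * ((b%:P - m%:R%:P) * q + 'X * q^`() - 'X * q) - q1); first by ring.
by rewrite -q1E; ring.
Qed.

(** Together with [deriv_rodrigues_poly] this is the contiguity relation
L_n^a = L_n^(a+1) - L_(n-1)^(a+1), up to factorials. *)
Lemma rodrigues_polyD1 b m :
  rodrigues_poly (b + 1) m = rodrigues_poly b m - (rodrigues_poly b m)^`().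
Proof.
elim: m => [|m IH]; first by rewrite /= -polyC1 derivC subr0.
rewrite /= IH; set q := rodrigues_poly b m.
rewrite !(derivB, derivD, derivM) derivC derivX !polyCB polyCD.
by ring.
Qed.

Lemma rodrigues_poly_at0 b m : (rodrigues_poly b m).[0] = \prod_(i < m) (b - i%:R).
Proof.
elim: m => [|m IH]; first by rewrite /= hornerE big_ord0.
by rewrite big_ord_recr /= !hornerE IH; ring.
Qed.

Lemma derive1n_powR_expRN b m x : 0 < x ->
  derive1n m (fun y => y `^ b * expR (- y)) x =
  x `^ (b - m%:R) * expR (- x) * (rodrigues_poly b m).[x].
Proof.
elim: m x => [|m IH] x x0; first by rewrite subr0 hornerE mulr1.
rewrite derive1nS derive1E.
set q := rodrigues_poly b m; set c := b - m%:R.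
have -> : 'D_1 (derive1n m (fun y => y `^ b * expR (- y))) x =
    'D_1 (fun y => y `^ c * expR (- y) * q.[y]) x.
  apply: near_eq_derive; near=> y; apply: IH.
  by near: y; exact: lt_nbhsr.
have dp : is_derive x 1 ((@powR R)^~ c) (c * x `^ (c - 1)).
  exact: is_derive1_powR.
have de : is_derive x 1 (fun y : R => expR (- y)) (- expR (- x)).
  have h : is_derive x 1 (-%R : R -> R) (-1) by apply: is_deriveN.
  have := @is_derive1_comp _ expR -%R x _ _ (is_derive_expR (- x)) h.
  by rewrite mulrN1.
have dq : is_derive x 1 (horner q) (q^`()).[x] by exact: is_derive_poly.
have /@derive_val -> := is_deriveM (is_deriveM dp de) dq.
transitivity (x `^ c * expR (- x) * (q^`()).[x] +
  q.[x] * (x `^ c * - expR (- x) + expR (- x) * (c * x `^ (c - 1)))) => //.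
rewrite [rodrigues_poly _ _]/= -/q -/c.
rewrite hornerD hornerN hornerD !hornerM hornerC hornerX.
have -> : x `^ c = x `^ (c - 1) * x.
  by rewrite -{3}(powRr1 (ltW x0)) -powRD ?subrK// (gt_eqF x0) implybT.
have -> : b - m.+1%:R = c - 1 by rewrite /c -natr1; ring.
by ring.
Unshelve. all: by end_near. Qed.

Lemma laguerre_rodrigues_poly n a :
  laguerre n a = (n`!%:R)^-1 *: rodrigues_poly (n%:R + a) n.
Proof.
apply: poly_eq_pos => x x0; rewrite laguerreE// /laguerre_rodrigues.
rewrite derive1n_powR_expRN// hornerZ addrAC subrr add0r powRN expRN.
have : x `^ a != 0 by rewrite gt_eqF// powR_gt0.
have : expR x != 0 by rewrite gt_eqF// expR_gt0.
have : n`!%:R != 0 :> R by rewrite pnatr_eq0 -lt0n fact_gt0.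
by move=> ? ? ?; field; apply/and3P.
Qed.

Lemma deriv_laguerre0 a : (laguerre 0 a)^`() = 0.
Proof. by rewrite laguerre_rodrigues_poly derivZ/= -polyC1 derivC scaler0. Qed.

(** The coefficient form of the equation (1 - z) dF/du = - z F for the generating
function; it is what the energy estimate uses about Laguerre polynomials. *)
Lemma deriv_laguerreS n a :
  (laguerre n.+1 a)^`() = (laguerre n a)^`() - laguerre n a.
Proof.
rewrite !laguerre_rodrigues_poly !derivZ deriv_rodrigues_poly.
have -> : n.+1%:R + a = n%:R + a + 1 by rewrite -natr1; ring.
rewrite rodrigues_polyD1 -scalerBr -mulrN opprB.
rewrite -[n.+1%:R : {poly R}]polyC_natr mul_polyC scalerA; congr (_ *: _).
by rewrite factS natrM invfM mulrAC mulVf ?mul1r.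
Qed.

Lemma laguerre0S n a :
  (laguerre n.+1 a).[0] = (1 + a / n.+1%:R) * (laguerre n a).[0].
Proof.
rewrite !laguerre_rodrigues_poly !hornerZ !rodrigues_poly_at0 big_ord_recl/=.
rewrite subr0 (eq_bigr (fun i : 'I_n => n%:R + a - i%:R)); last first.
  by move=> i _; rewrite /bump/= add1n -!natr1; ring.
rewrite factS natrM.
have : n`!%:R != 0 :> R by rewrite pnatr_eq0 -lt0n fact_gt0.
have : n%:R + 1 != 0 :> R by rewrite natr1 pnatr_eq0.
by move=> ? ?; rewrite -natr1; field; apply/andP.
Qed.

(** Each factor 1 + a / j of L_n(0) is at most (1 + 1 / j)^A by Bernoulli, and
these bounds telescope. *)
Lemma laguerre0_bound (A : nat) n a : -1 <= a -> a <= A%:R ->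
  0 <= (laguerre n a).[0] <= n.+1%:R ^+ A.
Proof.
move=> a1 aA; elim: n => [|n /andP[IH0 IH1]].
  by rewrite laguerre_rodrigues_poly/= !hornerE expr1n invr1 ler01 lexx.
have n0 : 0 < n.+1%:R :> R by rewrite ltr0n.
rewrite laguerre0S mulr_ge0//=; last first.
  rewrite -(ler_pM2r n0) mul0r mulrDl mul1r divfK ?gt_eqF//.
  by rewrite -natr1; have := ler0n R n; lra.
have bernoulli : 1 + a / n.+1%:R <= (1 + n.+1%:R^-1) ^+ A.
  apply: (@le_trans _ _ (1 + n.+1%:R^-1 *+ A)).
    by rewrite lerD2l mulrC -[leRHS]mulr_natr ler_wpM2l// invr_ge0 ltW.
  have i0 : 0 <= n.+1%:R^-1 :> R by rewrite invr_ge0 ltW.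
  elim: A {aA IH1} => [|A IHA]; first by rewrite mulr0n addr0 expr0.
  rewrite exprS mulrS.
  have : (1 + n.+1%:R^-1) * (1 + n.+1%:R^-1 *+ A) <= (1 + n.+1%:R^-1) * (1 + n.+1%:R^-1) ^+ A :> R.
    by rewrite ler_wpM2l// addr_ge0.
  apply: le_trans; have : 0 <= n.+1%:R^-1 * (n.+1%:R^-1 *+ A) :> R.
    by rewrite mulr_ge0// mulrn_wge0.
  by move: n.+1%:R^-1 (_ *+ A) => y z; lra.
apply: (@le_trans _ _ ((1 + n.+1%:R^-1) ^+ A * n.+1%:R ^+ A)).
  apply: (@le_trans _ _ ((1 + n.+1%:R^-1) ^+ A * (laguerre n a).[0])).
    by rewrite ler_wpM2r.
  by rewrite ler_wpM2l// exprn_ge0// addr_ge0// invr_ge0 ltW.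
by rewrite -exprMn mulrDl mul1r mulVf ?gt_eqF// natr1.
Qed.

(** * The energy estimate for Laguerre polynomials *)

(** With v and w the coefficients of V and W = (z / (1 - z)) V on the circle |z| = r,
this says that the real part of - z / (1 - z) is at most r / (1 + r) there. The
term w_N^2 / (2 r) added in the proof absorbs the effect of truncating at N:
with it, each step of the induction amounts to a square being nonnegative. *)
Lemma shift_form_le (v w : nat -> R) (r : R) (N : nat) : 0 < r < 1 ->
  w 0%N = 0 -> (forall n, w n.+1 = r * (w n + v n)) ->
  - \sum_(n < N) w n * v n <= r / (1 + r) * \sum_(n < N) v n ^+ 2.
Proof.
move=> /andP[r0 r1] w0 wS.
have r1' : 0 < 1 + r by rewrite addr_gt0.
suff : w N ^+ 2 / (2 * r) <=
    r / (1 + r) * \sum_(n < N) v n ^+ 2 + \sum_(n < N) w n * v n.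
  have : 0 <= w N ^+ 2 / (2 * r).
    by rewrite divr_ge0// ?sqr_ge0// mulr_ge0// ltW.
  by lra.
elim: N => [|N IH]; first by rewrite !big_ord0 w0 expr0n/= mul0r mulr0 addr0.
rewrite !big_ord_recr/= wS.
(* This nonnegative term is exactly the gap left by the induction step. *)
have : 0 <= (1 - r) * (1 + r) / (2 * r) * (w N + r / (1 + r) * v N) ^+ 2.
  by rewrite mulr_ge0 ?sqr_ge0// divr_ge0// mulr_ge0// ?subr_ge0 ltW.
have -> : (1 - r) * (1 + r) / (2 * r) * (w N + r / (1 + r) * v N) ^+ 2 =
   w N ^+ 2 / (2 * r) + r / (1 + r) * v N ^+ 2 + w N * v N -
   (r * (w N + v N)) ^+ 2 / (2 * r).
  by field; rewrite !gt_eqF.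
by move: IH; rewrite mulrDr; lra.
Qed.

Definition laguerre_energy (r a : R) N : {poly R} :=
  \sum_(n < N) (r ^+ n) ^+ 2 *: laguerre n a ^+ 2.

(** [shift_form_le] applied to v_n = r^n L_n(u) and w_n = - r^n L_n'(u). *)
Lemma deriv_laguerre_energy (r a : R) N u : 0 < r < 1 ->
  (laguerre_energy r a N)^`().[u] <= 2 * (r / (1 + r)) * (laguerre_energy r a N).[u].
Proof.
move=> r01; pose v n := r ^+ n * (laguerre n a).[u].
pose w n := - (r ^+ n * (laguerre n a)^`().[u]).
have : - \sum_(n < N) w n * v n <= r / (1 + r) * \sum_(n < N) v n ^+ 2.
  apply: shift_form_le => //.
    by rewrite /w deriv_laguerre0 horner0 mulr0 oppr0.
  by move=> n; rewrite /w /v deriv_laguerreS exprS hornerD hornerN; ring.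
rewrite /laguerre_energy (linear_sum (@deriv R)) !horner_sum.
have -> : \sum_(n < N) v n ^+ 2 = \sum_(n < N) ((r ^+ n) ^+ 2 *: laguerre n a ^+ 2).[u].
  by apply: eq_bigr => n _; rewrite hornerZ horner_exp -exprMn.
have -> : \sum_(n < N) ((r ^+ n) ^+ 2 *: laguerre n a ^+ 2)^`().[u] =
   2 * - \sum_(n < N) w n * v n.
  rewrite -sumrN mulr_sumr; apply: eq_bigr => n _.
  by rewrite /v /w derivZ (expr2 (laguerre _ _)) derivM hornerZ hornerD !hornerM; ring.
by lra.
Qed.

(** Gronwall: e^(- 2 c u) E(u) is nonincreasing. *)
Lemma laguerre_energy_le (r a : R) N u : 0 < r < 1 -> 0 <= u ->
  (laguerre_energy r a N).[u] <=
  expR (2 * (r / (1 + r)) * u) * (laguerre_energy r a N).[0].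
Proof.
move=> r01 u0; set P := laguerre_energy r a N; set c := 2 * (r / (1 + r)).
pose g y := expR (- (c * y)) * P.[y].
have dg (y : R) : is_derive y 1 g (expR (- (c * y)) * (P^`().[y] - c * P.[y])).
  have h : is_derive y 1 (fun y : R => - (c * y)) (- c).
    have := is_deriveN (is_deriveZ c (is_derive_id y 1)).
    by move=> H; apply: (is_derive_eq H); rewrite scaler1.
  have de := @is_derive1_comp _ expR _ y _ _ (is_derive_expR _) h.
  have dq : is_derive y 1 (horner P) (P^`()).[y] by exact: is_derive_poly.
  apply: (is_derive_eq (is_deriveM de dq)).
  by rewrite /GRing.scale /=; ring.
have : g u <= g 0.
  have gd (y : R) : y \in `]0, u[ -> derivable g y 1 by move=> _; exact: ex_derive.
  apply: (ler0_derive1_le_cc gd); rewrite ?in_itv/= ?lexx ?u0//.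
    move=> y _; rewrite derive1E (@derive_val _ _ _ _ _ _ _ (dg y)).
    by rewrite mulr_ge0_le0 ?expR_ge0// subr_le0 deriv_laguerre_energy.
  apply: derivable_within_continuous => y _; exact: ex_derive.
rewrite /g mulr0 oppr0 expR0 mul1r expRN => h.
by rewrite mulrC -ler_pdivrMr ?expR_gt0// mulrC.
Qed.

(** For r < 1 the exponential rate r / (1 + r) of |L_n(u)| is strictly below 1/2,
which is what leaves room for Gaussian decay later. *)
Lemma laguerre_sqr_le (A : nat) (r a : R) n u : 0 < r < 1 -> -1 <= a -> a <= A%:R ->
  0 <= u ->
  (r ^+ n * (laguerre n a).[u]) ^+ 2 <=
  n.+1%:R ^+ (2 * A).+1 * expR (2 * (r / (1 + r)) * u).
Proof.
move=> r01 a1 aA u0.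
apply: (@le_trans _ _ (laguerre_energy r a n.+1).[u]).
  rewrite horner_sum big_ord_recr/= hornerZ horner_exp -exprMn lerDr.
  apply: sumr_ge0 => i _; rewrite hornerZ horner_exp -exprMn.
  exact: sqr_ge0.
apply: (le_trans (laguerre_energy_le _ _ _ _ r01 u0)).
rewrite mulrC ler_wpM2r ?expR_ge0// horner_sum.
apply: (@le_trans _ _ (\sum_(i < n.+1) n.+1%:R ^+ (2 * A))); last first.
  by rewrite sumr_const card_ord exprSr mulr_natr.
apply: ler_sum => i _; rewrite hornerZ horner_exp -exprMn mulnC exprM.
have /andP[L0 L1] := laguerre0_bound A i a a1 aA.
have /andP[r0 r1] := r01.
rewrite lerXn2r// ?nnegrE ?mulr_ge0 ?exprn_ge0 ?(ltW r0)//.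
apply: (@le_trans _ _ (1 * (laguerre i a).[0])).
  by rewrite ler_wpM2r// exprn_ile1// ltW.
rewrite mul1r (le_trans L1)// lerXn2r ?nnegrE// ler_nat.
by rewrite ltn_ord.
Qed.

End Rodrigues.

(** * Growth of the normalising factor *)

Section Bounds.
Context {R : realType}.
Implicit Types (a b x u z s k : R) (m n : nat).
Local Notation mu := (@lebesgue_measure R).

Lemma expr_le_expR x n : 0 <= x -> x ^+ n <= n`!%:R * expR x.
Proof.
move=> x0; have f0 m : 0 < m`!%:R :> R by rewrite ltr0n fact_gt0.
rewrite mulrC -ler_pdivrMr//; case: n => [|n].
  by rewrite expr0 fact0 divr1 -expR0 ler_expR.
by apply: le_trans (expR_ge1Dxn n x0); rewrite lerDr.
Qed.

(** A crude form of Stirling's upper bound, from 1 - 1 / (m + 2) <= e^(- 1 / (m + 2)). *)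
Lemma fact_le_expR m : m`!%:R <= m.+1%:R ^+ m.+1 * expR (- m%:R) :> R.
Proof.
elim: m => [|m IH]; first by rewrite fact0 expr1 oppr0 expR0 mul1r.
have m2 : 0 < m.+2%:R :> R by rewrite ltr0n.
rewrite factS natrM.
apply: (@le_trans _ _ (m.+1%:R * (m.+1%:R ^+ m.+1 * expR (- m%:R)))).
  by rewrite ler_wpM2l.
have step : m.+1%:R ^+ m.+2 * expR 1 <= m.+2%:R ^+ m.+2 :> R.
  have : (m.+1%:R / m.+2%:R) ^+ m.+2 <= expR (- 1) :> R.
    have -> : -1 = m.+2%:R * - m.+2%:R^-1 :> R by rewrite mulrN mulfV ?gt_eqF.
    rewrite expRM_natl lerXn2r// ?nnegrE ?divr_ge0 ?expR_ge0//.
    apply: le_trans (expR_ge1Dx _); rewrite ler_pdivrMr// mulrBl mul1r.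
    by rewrite mulVf ?gt_eqF// -[m.+2%:R]natr1 addrK.
  by rewrite expr_div_n expRN ler_pdivrMr ?exprn_gt0// mulrC ler_pdivlMr ?expR_gt0.
rewrite (_ : - m.+1%:R = -1 - m%:R); last by rewrite -[m.+1%:R]natr1; ring.
rewrite expRD !mulrA -exprS ler_wpM2r ?expR_ge0//.
by rewrite expRN ler_pdivlMr ?expR_gt0.
Qed.

Lemma measurable_Gamma_integrand z (D : set R) :
  measurable_fun D (fun x => x `^ z * expR (- x)).
Proof.
apply: (@measurable_funS _ _ _ _ setT) => //.
apply: measurable_funM; first exact: measurable_powR.
by apply: measurableT_comp => //; exact: oppr_measurable.
Qed.

(** The integrand of Gamma z is at least (m + 1)^m e^(- (m + 2)) / (m + 2) on
[m + 1, m + 2]; writing x^(z - 1) as x^z / x makes one bound serve for z - 1 of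
either sign when m = 0. Comparison with [fact_le_expR] leaves a polynomial. *)
Lemma fact_div_Gamma_bound m z : m%:R <= z ->
  0 <= m`!%:R / Gamma z <= expR 2 * (m.+1%:R * m.+2%:R).
Proof.
move=> mz.
have m1 : 0 < m.+1%:R :> R by rewrite ltr0n.
have m2 : 0 < m.+2%:R :> R by rewrite ltr0n.
(* l bounds the integrand of Gamma z from below on [m + 1, m + 2]. *)
pose l : R := m.+1%:R ^+ m * expR (- m.+2%:R) / m.+2%:R.
have l0 : 0 < l by rewrite divr_gt0// mulr_gt0 ?expR_gt0// exprn_gt0.
have lI : (l%:E <= \int[mu]_(x in `]0%R, +oo[) (x `^ (z - 1) * expR (- x))%:E)%E.
  pose J : set R := `[m.+1%:R, m.+2%:R]%classic.
  have mJ : measurable J by exact: measurable_itv.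
  apply: (@le_trans _ _ (\int[mu]_(x in J) (x `^ (z - 1) * expR (- x))%:E)%E); last first.
    apply: ge0_subset_integral => //.
    - by apply/measurable_EFinP; exact: measurable_Gamma_integrand.
    - by move=> x _; rewrite lee_fin mulr_ge0 ?powR_ge0 ?expR_ge0.
    - move=> x; rewrite /J /= !in_itv/= andbT => /andP[+ _].
      exact: lt_le_trans.
  apply: (@le_trans _ _ (\int[mu]_(x in J) (cst l%:E) x)%E).
    rewrite integral_cst//= lebesgue_measure_itv/= lte_fin ltr_nat ltnSn.
    by rewrite -EFinB -[m.+2%:R]natr1 addrAC subrr add0r mule1.
  apply: ge0_le_integral => //.
  - by move=> x _; rewrite lee_fin ltW.
  - by apply/measurable_EFinP; exact: measurable_Gamma_integrand.
  move=> x; rewrite /J/= in_itv/= => /andP[mx xm]; rewrite lee_fin.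
  have x1 : 1 <= x by apply: le_trans mx; rewrite ler1n.
  have x0 : 0 < x by apply: lt_le_trans x1.
  have xz : m.+1%:R ^+ m <= x `^ (z - 1) * x.
    rewrite -[in X in _ * X](powRr1 (ltW x0)) -powRD; last by rewrite (gt_eqF x0) implybT.
    rewrite subrK (@le_trans _ _ (x ^+ m))//.
      by rewrite lerXn2r// ?nnegrE ltW.
    by rewrite -powR_mulrn ?(ltW x0)// ler_powR.
  rewrite /l mulrAC ler_pM ?expR_ge0 ?divr_ge0 ?exprn_ge0//; last first.
    by rewrite ler_expR lerN2.
  rewrite ler_pdivrMr//; apply: (le_trans xz).
  by rewrite ler_wpM2l// powR_ge0.
have C0 : 0 <= expR 2 * (m.+1%:R * m.+2%:R) :> R.
  by rewrite mulr_ge0 ?expR_ge0// mulr_ge0.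
rewrite /Gamma /Rintegral; move: lI.
(* If the integral were infinite, its real value 0 would make the quotient 0. *)
case: (integral _ _ _) => [g| |]//=; last by rewrite invr0 mulr0 lexx C0.
rewrite lee_fin => lg; have g0 : 0 < g by apply: lt_le_trans lg.
rewrite divr_ge0 ?(ltW g0)//= ler_pdivrMr//.
apply: (le_trans (fact_le_expR m)).
apply: le_trans (ler_wpM2l C0 lg); rewrite /l.
rewrite le_eqVlt; apply/orP; left; apply/eqP.
rewrite (_ : - m.+2%:R = - m%:R - 2); last by rewrite -!natr1; ring.
rewrite [expR (_ - 2)]expRD [expR (-2)]expRN exprS.
by field; rewrite gt_eqF//= gt_eqF ?expR_gt0.
Qed.

(** * Bounds on the Dunkl-Hermite functions *)

Lemma polynomial_le_expR s n : 0 < s -> exists2 C : R, 0 <= C &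
  forall i, i.+2%:R ^+ n <= C * expR (s * i%:R).
Proof.
move=> s0; exists (n`!%:R * expR (s * 2) / s ^+ n).
  by rewrite divr_ge0 ?mulr_ge0 ?expR_ge0 ?exprn_ge0// ltW.
move=> i; rewrite mulrAC ler_pdivlMr ?exprn_gt0// -exprMn mulrC.
rewrite -mulrA -expRD -mulrDr -[2]/(2%:R) -natrD add2n.
by apply: expr_le_expR; rewrite mulr_ge0// ltW.
Qed.

(** The even and the odd Dunkl-Hermite functions differ, apart from a factor x, only
in the Laguerre parameter and in the argument of Gamma, so both are covered by
an arbitrary a and an arbitrary z >= m. *)
Lemma laguerre_hermite_bound (A : nat) s a : 0 < s -> -1 <= a -> a <= A%:R ->
  exists C d : R, [/\ 0 <= C, 0 < d & forall m z x, m%:R <= z ->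
    (expR (- (x ^+ 2 / 2)) * ((-1) ^+ m * Num.sqrt (m`!%:R / Gamma z) *
      (laguerre m a).[x ^+ 2])) ^+ 2 <=
    C * expR (s * (m.*2)%:R) * expR (- (d * x ^+ 2))].
Proof.
move=> s0 a1 aA; pose t := s / 2; pose r := expR (- t).
have t0 : 0 < t by rewrite divr_gt0.
have r01 : 0 < r < 1 by rewrite expR_gt0 -[X in _ < X]expR0 ltr_expR oppr_lt0.
have [r0 r1] := andP r01.
have [C C0 HC] := polynomial_le_expR s (2 * A + 3) s0.
exists (expR 2 * C), (1 - 2 * (r / (1 + r))); split.
- by rewrite mulr_ge0 ?expR_ge0.
- rewrite subr_gt0 mulrA ltr_pdivrMr ?addr_gt0// mul1r; lra.
move=> m z x mz.
have /andP[G0 G1] := fact_div_Gamma_bound m z mz.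
have x0 : 0 <= x ^+ 2 by exact: sqr_ge0.
have L := laguerre_sqr_le A r a m (x ^+ 2) r01 a1 aA x0.
set c := 2 * (r / (1 + r)) in L *.
set L1 := (laguerre m a).[x ^+ 2] in L *.
rewrite !exprMn sqr_sqrtr// -exprM mulnC exprM sqrrN !expr1n mul1r.
have {}L : L1 ^+ 2 <= m.+1%:R ^+ (2 * A).+1 * expR (c * x ^+ 2) * expR (s * m%:R).
  have rE : r ^+ m ^+ 2 * expR (s * m%:R) = 1.
    rewrite /r -exprM -expRM_natl -expRD natrM /t.
    by rewrite (_ : _ + _ = 0) ?expR0//; field.
  have -> : L1 ^+ 2 = (r ^+ m * L1) ^+ 2 * expR (s * m%:R).
    by rewrite exprMn mulrAC rE mul1r.
  by rewrite ler_wpM2r ?expR_ge0.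
have E1 : expR (- (x ^+ 2 / 2)) ^+ 2 = expR (- (x ^+ 2)).
  by rewrite -expRM_natl; congr expR; field.
rewrite E1.
have P1 : m.+1%:R * m.+2%:R * m.+1%:R ^+ (2 * A).+1 <= m.+2%:R ^+ (2 * A + 3) :> R.
  rewrite (_ : (2 * A + 3 = 2 + (2 * A).+1)%N); last by rewrite !addnS addn0.
  rewrite exprD ler_pM ?mulr_ge0 ?exprn_ge0//.
    by rewrite expr2 ler_wpM2r// ler_nat.
  by rewrite lerXn2r// ?nnegrE// ler_nat.
have {}HC := HC m.
apply: (@le_trans _ _ (expR (- x ^+ 2) * (expR 2 * (m.+1%:R * m.+2%:R) *
   (m.+1%:R ^+ (2 * A).+1 * expR (c * x ^+ 2) * expR (s * m%:R))))).
  rewrite ler_wpM2l ?expR_ge0// ler_pM ?sqr_ge0//.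
have -> : expR (- x ^+ 2) * (expR 2 * (m.+1%:R * m.+2%:R) *
   (m.+1%:R ^+ (2 * A).+1 * expR (c * x ^+ 2) * expR (s * m%:R))) =
   (m.+1%:R * m.+2%:R * m.+1%:R ^+ (2 * A).+1) * (expR 2 *
    (expR (- x ^+ 2) * expR (c * x ^+ 2)) * expR (s * m%:R)) by ring.
have -> : expR 2 * C * expR (s * m.*2%:R) * expR (- ((1 - c) * x ^+ 2)) =
   C * expR (s * m%:R) * (expR 2 *
    (expR (- x ^+ 2) * expR (c * x ^+ 2)) * expR (s * m%:R)).
  rewrite -[expR (- _) * expR (c * _)]expRD (_ : - x ^+ 2 + c * x ^+ 2 = - ((1 - c) * x ^+ 2)); last by ring.
  rewrite -addnn natrD mulrDr [expR (s * _ + _)]expRD; ring.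
by rewrite ler_wpM2r ?mulr_ge0 ?expR_ge0// (le_trans P1).
Qed.

(** The factor x of the odd functions is absorbed by half of the Gaussian decay,
which is why the minimum of de and d_o / 2 appears. *)
Lemma dunkl_hermite_bound k s : 0 <= k -> 0 < s ->
  exists C d : R, [/\ 0 <= C, 0 < d & forall n x,
    `|dunkl_hermite k n x| <= C * expR (s * n%:R) * expR (- (d * x ^+ 2))].
Proof.
move=> k0 s0; have s2 : 0 < 2 * s by rewrite mulr_gt0.
pose A := (Num.truncn k).+2.
have kA : k + 1 / 2 <= A%:R.
  by have /ltW := truncnS_gt k; rewrite /A -[in leRHS]natr1; lra.
have [|||Ce [de [Ce0 de0 He]]] := laguerre_hermite_bound A (2 * s) (k - 1 / 2); try lra.
have [|||Co [d_o [Co0 do0 Ho]]] := laguerre_hermite_bound A (2 * s) (k + 1 / 2); try lra.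
pose C := Ce + 2 * Co / d_o + 1.
pose d := Num.min de (d_o / 2).
have d0 : 0 < d by rewrite lt_min de0 divr_gt0.
have C1 : 0 <= 2 * Co / d_o by rewrite divr_ge0 ?mulr_ge0// ltW.
exists C, (d / 2); split.
- by rewrite /C !addr_ge0.
- by rewrite divr_gt0.
move=> n x.
have C_ge0 : 0 <= C by rewrite /C !addr_ge0.
have ge0 : 0 <= C * expR (s * n%:R) * expR (- (d / 2 * x ^+ 2)).
  by rewrite !mulr_ge0 ?expR_ge0.
rewrite -(ler_sqr (normr_ge0 _)) ?nnegrE// real_normK ?num_real//.
have -> : (C * expR (s * n%:R) * expR (- (d / 2 * x ^+ 2))) ^+ 2 =
   C ^+ 2 * expR (2 * s * n%:R) * expR (- (d * x ^+ 2)).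
  rewrite !exprMn -[X in _ * X * _]expRM_natl -[X in _ * X]expRM_natl.
  by congr (_ * expR _ * expR _); field.
have CC : C <= C ^+ 2.
  by rewrite expr2 ler_peMl// /C -[leLHS]add0r lerD// addr_ge0.
apply: (@le_trans _ _ (C * expR (2 * s * n%:R) * expR (- (d * x ^+ 2)))); last first.
  by rewrite !ler_wpM2r ?expR_ge0.
have x0 : 0 <= x ^+ 2 by exact: sqr_ge0.
rewrite /dunkl_hermite /dunkl_hermite_poly; case: ifP => nodd.
  have nE : n = (n./2).*2.+1 by rewrite -{1}(odd_double_half n) nodd.
  have mz : n./2%:R <= n./2%:R + k + 3 / 2 by lra.
  have H := Ho n./2 _ x mz.
  set q := Num.sqrt _ in H *; set L := (laguerre _ _).[_] in H *.
  rewrite (_ : _ * (_ * x * L) = x * (expR (- (x ^+ 2 / 2)) * ((-1) ^+ n./2 * q * L))); last by ring.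
  rewrite exprMn (le_trans (ler_wpM2l x0 H))//.
  have xe : x ^+ 2 * expR (- (d_o * x ^+ 2)) <= 2 / d_o * expR (- (d * x ^+ 2)).
    have : d_o / 2 * x ^+ 2 <= expR (d_o / 2 * x ^+ 2).
      by apply: le_trans (expR_ge1Dx _); rewrite lerDr.
    rewrite -ler_pdivlMl ?divr_gt0// invf_div => xe.
    apply: (le_trans (ler_wpM2r (expR_ge0 _) xe)).
    rewrite -(mulrA (2 / d_o)) ler_wpM2l ?divr_ge0 ?(ltW do0)// -expRD ler_expR.
    have : d <= d_o / 2 by rewrite ge_min lexx orbT.
    by move=> /(ler_wpM2r x0); lra.
  rewrite [leLHS](_ : _ = Co * (expR (2 * s * (n./2).*2%:R) *
    (x ^+ 2 * expR (- (d_o * x ^+ 2))))); last by ring.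
  apply: (@le_trans _ _ (Co * (expR (2 * s * n%:R) * (2 / d_o * expR (- (d * x ^+ 2)))))).
    rewrite ler_wpM2l// ler_pM ?expR_ge0 ?(mulr_ge0 x0) ?expR_ge0//.
    by rewrite ler_expR ler_wpM2l ?(ltW s2)// ler_nat {2}nE.
  rewrite (_ : Co * _ = 2 * Co / d_o * expR (2 * s * n%:R) * expR (- (d * x ^+ 2))); last by ring.
  rewrite !ler_wpM2r ?expR_ge0// /C; lra.
have nE : n = (n./2).*2 by rewrite -{1}(odd_double_half n) nodd.
have mz : n./2%:R <= n./2%:R + k + 1 / 2 by lra.
have H := He n./2 _ x mz.
apply: (le_trans H); rewrite -nE ler_pM ?mulr_ge0 ?expR_ge0//.
  rewrite ler_wpM2r ?expR_ge0// /C; lra.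
rewrite ler_expR lerN2 ler_wpM2r// ge_min lexx//.
Qed.

End Bounds.

(** * Integrability against Gaussians *)

Section Integrability.
Context {R : realType}.
Implicit Types (k p t x y : R) (f : R -> R) (n : nat).
Local Notation mu := (@lebesgue_measure R).

Lemma measurable_dunkl_weight k : measurable_fun setT (@dunkl_weight R k).
Proof.
apply: (measurableT_comp (measurable_powR _)).
exact: normr_measurable.
Qed.

Lemma measurable_horner (q : {poly R}) : measurable_fun setT (horner q).
Proof. by apply: continuous_measurable_fun; exact: continuous_horner. Qed.

Lemma measurable_dunkl_hermite k n : measurable_fun setT (@dunkl_hermite R k n).
Proof.
have mX2 : measurable_fun setT (fun x : R => x ^+ 2) by exact: measurable_funX.
apply: measurable_funM.
  apply: measurableT_comp => //; apply: measurableT_comp; first exact: oppr_measurable.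
  exact: measurable_funM.
rewrite /dunkl_hermite_poly; case: (odd n).
  apply: measurable_funM; first by apply: measurable_funM => //.
  exact: measurableT_comp (measurable_horner _) mX2.
apply: measurable_funM => //.
exact: measurableT_comp (measurable_horner _) mX2.
Qed.

Lemma integrable_gaussian (d : R) : 0 < d ->
  mu.-integrable setT (fun x => (expR (- (d * x ^+ 2)))%:E).
Proof.
move=> d0; pose s := Num.sqrt (2 * d)^-1.
have s0 : 0 < s by rewrite sqrtr_gt0 invr_gt0 mulr_gt0.
have sE : s ^+ 2 = (2 * d)^-1 by rewrite sqr_sqrtr// invr_ge0 mulr_ge0// ltW.
have := integrableZl measurableT (normal_peak s)^-1 (integrable_normal_pdf 0 s).
congr (integrable _ _ _); apply/funext => x.
rewrite -EFinM normal_pdfE ?gt_eqF// mulKf ?gt_eqF ?normal_peak_gt0 ?gt_eqF//.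
rewrite /normal_fun subr0 sE; congr (expR _)%:E.
by field; rewrite gt_eqF.
Qed.

Lemma dunkl_weight_le_expR k (d : R) : 0 <= k -> 0 < d -> exists2 C : R, 0 <= C &
  forall x, dunkl_weight k x <= C * expR (d * x ^+ 2).
Proof.
move=> k0 d0; pose K := (Num.truncn k).+1.
exists (1 + K`!%:R / d ^+ K).
  by rewrite addr_ge0// divr_ge0// exprn_ge0// ltW.
move=> x; have x0 : 0 <= x ^+ 2 by exact: sqr_ge0.
have dx0 : 0 <= d * x ^+ 2 by rewrite mulr_ge0// ltW.
have e1 : 1 <= expR (d * x ^+ 2) by rewrite -expR0 ler_expR.
have xK : (x ^+ 2) ^+ K <= K`!%:R / d ^+ K * expR (d * x ^+ 2).
  rewrite mulrAC ler_pdivlMr ?exprn_gt0// -exprMn [x ^+ 2 * d]mulrC.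
  exact: expr_le_expR.
have -> : dunkl_weight k x = (x ^+ 2) `^ k.
  by rewrite /dunkl_weight powRrM powR_mulrn// real_normK// num_real.
rewrite mulrDl mul1r; have [x1|/ltW x1] := leP (x ^+ 2) 1.
  apply: (@le_trans _ _ 1).
    have <- : 1 `^ k = 1 :> R by rewrite powR1.
    by rewrite ge0_ler_powR// nnegrE.
  by rewrite (le_trans e1)// lerDl mulr_ge0 ?expR_ge0// divr_ge0// exprn_ge0// ltW.
apply: (@le_trans _ _ ((x ^+ 2) ^+ K)).
  by rewrite -(powR_mulrn K x0) ler_powR// ltW// truncnS_gt.
by rewrite (le_trans xK)// lerDr expR_ge0.
Qed.

Lemma integrable_gaussian_weight k (d : R) : 0 <= k -> 0 < d ->
  mu.-integrable setT (fun x => (expR (- (d * x ^+ 2)) * dunkl_weight k x)%:E).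
Proof.
move=> k0 d0; have d20 : 0 < d / 2 by rewrite divr_gt0.
have [C C0 HC] := dunkl_weight_le_expR k (d / 2) k0 d20.
apply: le_integrable (integrableZl measurableT C (integrable_gaussian _ d20)) => //.
  apply/measurable_EFinP; apply: measurable_funM; last exact: measurable_dunkl_weight.
  by have /measurable_int/measurable_EFinP := integrable_gaussian d d0.
move=> x _; rewrite -EFinM !abse_EFin lee_fin !ger0_norm ?mulr_ge0 ?expR_ge0 ?powR_ge0//.
apply: (le_trans (ler_wpM2l (expR_ge0 _) (HC x))).
rewrite mulrCA -expRD ler_wpM2l// ler_expR.
lra.
Qed.

(** With e the Gaussian, e |f| <= |f|^p + e: where |f| <= 1 the second summand
suffices, elsewhere |f| <= |f|^p and e <= 1. *)
Lemma integrable_Lp_gaussian k p f (d : R) : 0 <= k -> 1 <= p -> 0 < d ->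
  dunkl_Lp k p f ->
  mu.-integrable setT
    (fun x => (expR (- (d * x ^+ 2)) * `|f x| * dunkl_weight k x)%:E).
Proof.
move=> k0 p1 d0 [mf fp]; have p0 : 0 < p by apply: lt_le_trans p1.
have mw := measurable_dunkl_weight k.
have mnf : measurable_fun setT (fun x => `|f x|) by exact: measurableT_comp.
have mfp : measurable_fun setT (fun x => `|f x| `^ p * dunkl_weight k x).
  apply: measurable_funM => //.
  exact: (measurableT_comp (measurable_powR p)).
have ifp : mu.-integrable setT (fun x => (`|f x| `^ p * dunkl_weight k x)%:E).
  apply/integrableP; split; first exact/measurable_EFinP.
  under eq_integral do rewrite abse_EFin ger0_norm ?mulr_ge0 ?powR_ge0//.
  by apply: lty_poweRy fp; rewrite invr_neq0// gt_eqF.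
have ig := integrable_gaussian_weight k d k0 d0.
apply: le_integrable (integrableD measurableT ifp ig) => //.
  apply/measurable_EFinP; apply: measurable_funM => //; apply: measurable_funM => //.
  by have /measurable_int/measurable_EFinP := integrable_gaussian d d0.
move=> x _; rewrite -EFinD !abse_EFin lee_fin.
rewrite [leLHS]ger0_norm ?mulr_ge0 ?powR_ge0 ?expR_ge0//.
rewrite [leRHS]ger0_norm ?addr_ge0 ?mulr_ge0 ?powR_ge0 ?expR_ge0//.
rewrite -mulrDl ler_wpM2r ?powR_ge0//.
have [f1|/ltW f1] := leP `|f x| 1.
  apply: (@le_trans _ _ (expR (- (d * x ^+ 2)))); last by rewrite lerDr powR_ge0.
  by rewrite ler_piMr ?expR_ge0.
apply: (@le_trans _ _ (`|f x| `^ p)); last by rewrite lerDl expR_ge0.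
apply: (@le_trans _ _ `|f x|).
  rewrite ler_piMl// -expR0 ler_expR oppr_le0 mulr_ge0 ?sqr_ge0// ltW//.
by rewrite -[leLHS](powRr1 (normr_ge0 _)) ler_powR.
Qed.

End Integrability.

(** * Termwise integration of a series *)

Lemma cvg_series_geometric_le (R : realType) (u : nat -> R) (c q : R) :
  0 <= q < 1 -> (forall n, `|u n| <= q ^+ n * c) -> cvgn (series u).
Proof.
move=> /andP[q0 q1] uc; apply: normed_cvg.
have c0 : 0 <= c by have := uc 0; rewrite expr0 mul1r; exact: le_trans.
apply: (@series_le_cvg _ _ (geometric c q)) => //.
- by move=> n; exact: normr_ge0.
- by move=> n; rewrite /= mulr_ge0// exprn_ge0.
- by move=> n; rewrite /= mulrC.
- by apply: is_cvg_geometric_series; rewrite ger0_norm.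
Qed.

Section TermByTerm.
Context d (T : measurableType d) (R : realType) (mu : {measure set T -> \bar R}).
Variables (phi : nat -> T -> R) (g : T -> R) (q : R).
Hypotheses (q01 : 0 <= q < 1) (mphi : forall n, measurable_fun setT (phi n)).
Hypothesis ig : mu.-integrable setT (EFin \o g).
Hypothesis phi_le : forall n y, `|phi n y| <= q ^+ n * g y.

Let g_ge0 y : 0 <= g y.
Proof. by have := phi_le 0 y; rewrite expr0 mul1r; exact: le_trans. Qed.

Lemma integrable_geometric_dominated n : mu.-integrable setT (EFin \o phi n).
Proof.
apply: le_integrable ig => //; first exact/measurable_EFinP.
move=> y _ /=; rewrite lee_fin (le_trans (phi_le n y))// ger0_norm//.
by have /andP[q0 q1] := q01; rewrite ler_piMl// exprn_ile1// ltW.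
Qed.

(** Dominated convergence of the partial sums, with dominating function g / (1 - q). *)
Lemma Rintegral_geometric_dominated :
  mu.-integrable setT (fun y => (limn (series (phi ^~ y)))%:E) /\
  series (fun n => \int[mu]_y phi n y) @ \oo -->
  \int[mu]_y limn (series (phi ^~ y)).
Proof.
have /andP[q0 q1] := q01; have q1' : 0 < 1 - q by rewrite subr_gt0.
pose F N y := (series (phi ^~ y) N)%:E.
have mF N : measurable_fun setT (F N).
  apply/measurable_EFinP; exact: measurable_sum.
have F_cvg y : F ^~ y @ \oo --> (limn (series (phi ^~ y)))%:E.
  apply: cvg_EFin; first exact: nearW.
  exact: (cvg_series_geometric_le _ _ _ _ q01 (phi_le ^~ y)).
have F_le N y : (`|F N y| <= (1 - q)^-1%:E * (EFin \o g) y)%E.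
  rewrite /F abse_EFin -EFinM lee_fin (le_trans (ler_norm_sum _ _ _))//.
  apply: (@le_trans _ _ (\sum_(0 <= n < N) q ^+ n * g y)).
    by apply: ler_sum => n _; exact: phi_le.
  rewrite -mulr_suml ler_wpM2r// -[leRHS]mul1r.
  have -> : \sum_(0 <= n < N) q ^+ n = (1 - q ^+ N) / (1 - q).
    have /(congr1 (@^~ N)) := geometric_seriesE 1 (negbT (lt_eqF q1)).
    by rewrite /series/= mul1r; under eq_bigr do rewrite mul1r.
  by rewrite ler_wpM2r ?invr_ge0 ?(ltW q1')// gerBl exprn_ge0.
have mlim := emeasurable_fun_cvg F (fun y => (limn (series (phi ^~ y)))%:E) mF
  (fun y _ => F_cvg y).
have [||ilim _ H] := dominated_convergence measurableT mF mlim _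
  (integrableZl measurableT (1 - q)^-1 ig) _.
- by apply: aeW => y _; exact: F_cvg.
- by apply: aeW => y N _; exact: F_le.
split => //.
have E : fine \o (fun N => \int[mu]_y F N y)%E = series (fun n => \int[mu]_y phi n y).
  apply/funext => N; rewrite /F /series/=.
  under eq_integral do rewrite -sumEFin.
  rewrite integral_sum//; last exact: integrable_geometric_dominated.
  rewrite -sum_fine// => n _; apply: integrable_fin_num => //.
  exact: integrable_geometric_dominated.
rewrite -E; apply: fine_cvg; rewrite fineK//.
exact: integrable_fin_num ilim.
Qed.

End TermByTerm.

(** * The heat-diffusion integral *)

Lemma integrable_dunkl_coef (R : realType) (k p : R) (f : R -> R) (n : nat) :
  0 <= k -> 1 <= p -> dunkl_Lp k p f -> (@lebesgue_measure R).-integrable setT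
    (fun y => (f y * dunkl_hermite k n y * dunkl_weight k y)%:E).
Proof.
move=> k0 p1 fLp; have [C [d [C0 d0 hC]]] := dunkl_hermite_bound k 1 k0 ltr01.
have ig := integrable_Lp_gaussian k p f d k0 p1 d0 fLp.
apply: le_integrable (integrableZl measurableT (C * expR n%:R) ig) => //.
  apply/measurable_EFinP; apply: measurable_funM; last exact: measurable_dunkl_weight.
  by apply: measurable_funM; [case: fLp|exact: measurable_dunkl_hermite].
move=> y _; rewrite -EFinM !abse_EFin lee_fin.
have w0 : 0 <= dunkl_weight k y by exact: powR_ge0.
rewrite [leRHS]ger0_norm ?mulr_ge0 ?expR_ge0//.
have := hC n y; rewrite mul1r; move: (dunkl_hermite k n y) => h hle.
rewrite !normrM (ger0_norm w0) (mulrC `|f y|).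
rewrite [leRHS](_ : _ = C * expR n%:R * expR (- (d * y ^+ 2)) * `|f y| *
  dunkl_weight k y); last by ring.
by rewrite !ler_wpM2r.
Qed.

Section HeatExchange.
Context {R : realType}.
Variables (k p t x : R) (f : R -> R).
Hypotheses (k0 : 0 <= k) (p1 : 1 <= p) (fLp : dunkl_Lp k p f) (t0 : 0 < t).
Local Notation mu := (@lebesgue_measure R).

(** In the bound on h_n take rate t / 2 for both h_n(x) and h_n(y): of the decay
e^(- 2 t n) there remains e^(- t n). *)
Lemma dunkl_kernel_term_dominated : exists2 g : R -> R,
  mu.-integrable setT (fun y => (g y * `|f y| * dunkl_weight k y)%:E) &
  forall n y, `|dunkl_kernel_term k t x y n| <= expR (- t) ^+ n * g y.
Proof.
have s0 : 0 < t / 2 by rewrite divr_gt0.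
have [C [d [C0 d0 hC]]] := dunkl_hermite_bound k (t / 2) k0 s0.
exists (fun y => C ^+ 2 * expR (- (d * y ^+ 2))).
  have := integrableZl measurableT (C ^+ 2) (integrable_Lp_gaussian k p f d k0 p1 d0 fLp).
  by congr (integrable _ _ _); apply/funext => y; rewrite -EFinM !mulrA.
move=> n y; rewrite /dunkl_kernel_term.
have hx := hC n x; have hy := hC n y.
move: (dunkl_hermite k n x) (dunkl_hermite k n y) hx hy => hx hy hxC hyC.
rewrite !normrM ger0_norm ?expR_ge0//.
apply: (@le_trans _ _ (expR (- t * (2 * n%:R + 2 * k + 1)) *
   (C * expR (t / 2 * n%:R)) * (C * expR (t / 2 * n%:R) * expR (- (d * y ^+ 2))))).
  rewrite ler_pM ?mulr_ge0 ?expR_ge0// ler_wpM2l ?expR_ge0// (le_trans hxC)//.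
  rewrite ler_piMr ?mulr_ge0 ?expR_ge0// -expR0 ler_expR oppr_le0.
  by rewrite mulr_ge0 ?sqr_ge0// ltW.
rewrite [leLHS](_ : _ = C ^+ 2 * expR (- (d * y ^+ 2)) *
  (expR (- t * (2 * n%:R + 2 * k + 1)) * (expR (t / 2 * n%:R) * expR (t / 2 * n%:R)))).
  rewrite mulrC ler_wpM2r ?mulr_ge0 ?exprn_ge0 ?expR_ge0//.
  rewrite -!expRD -expRM_natl ler_expR.
  have : 0 <= t * (2 * k + 1) by rewrite mulr_ge0 ?(ltW t0)// addr_ge0// mulr_ge0.
  by move: (n%:R) => N; lra.
by ring.
Qed.

Lemma heat_kernel_representation :
  [/\ forall y, cvgn (series (dunkl_kernel_term k t x y)),
      mu.-integrable setT
        (fun y => (dunkl_kernel k t x y * f y * dunkl_weight k y)%:E)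
    & series (dunkl_heat_term k f t x) @ \oo -->
      \int[mu]_y (dunkl_kernel k t x y * f y * dunkl_weight k y)].
Proof.
have [g ig hg] := dunkl_kernel_term_dominated.
have q01 : 0 <= expR (- t) < 1.
  by rewrite expR_ge0 -[X in _ < X]expR0 ltr_expR oppr_lt0.
have cK y : cvgn (series (dunkl_kernel_term k t x y)).
  exact: (cvg_series_geometric_le _ _ _ _ q01 (hg ^~ y)).
pose fw y := f y * dunkl_weight k y.
pose phi n y := dunkl_kernel_term k t x y n * fw y.
have mfw : measurable_fun setT fw.
  by apply: measurable_funM; [case: fLp|exact: measurable_dunkl_weight].
have mphi n : measurable_fun setT (phi n).
  apply: measurable_funM => //; apply: measurable_funM => //.
  exact: measurable_dunkl_hermite.
have phi_le n y : `|phi n y| <= expR (- t) ^+ n * (g y * `|f y| * dunkl_weight k y).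
  have w0 : 0 <= dunkl_weight k y by exact: powR_ge0.
  have := hg n y; rewrite /phi /fw; move: (dunkl_kernel_term k t x y n) => K hK.
  by rewrite !normrM (ger0_norm w0) !mulrA !ler_wpM2r.
have phi_lim y : limn (series (phi ^~ y)) = dunkl_kernel k t x y * f y * dunkl_weight k y.
  rewrite -mulrA -/(fw y) /dunkl_kernel.
  have -> : series (phi ^~ y) = (fun N => series (dunkl_kernel_term k t x y) N * fw y).
    by apply/funext => N; rewrite /series/= mulr_suml.
  by apply/cvg_lim => //; exact: cvgM (cK y) (cvg_cst _).
have phi_int n : \int[mu]_y phi n y = dunkl_heat_term k f t x n.
  have ic := integrable_dunkl_coef _ k p f n k0 p1 fLp.
  rewrite /dunkl_heat_term /dunkl_hermite_coef mulrAC -RintegralZl//.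
  by apply: eq_Rintegral => y _; rewrite /phi /fw /dunkl_kernel_term; ring.
have [i1 i2] := Rintegral_geometric_dominated _ _ _ mu phi _ _ q01 mphi ig phi_le.
split => //.
  by move: i1; under eq_fun do rewrite phi_lim.
move: i2; under eq_fun do rewrite phi_int.
by under eq_Rintegral do rewrite phi_lim.
Qed.

End HeatExchange.

Theorem proposition4 (R : realType) (k p : R) (f : R -> R)
    (k_ge0 : 0 <= k) (p_ge1 : 1 <= p) (f_Lp : dunkl_Lp k p f) :
  forall (t x : R), 0 < t ->
    [/\ forall n : nat, (@lebesgue_measure R).-integrable setT
          (fun y => (f y * dunkl_hermite k n y * dunkl_weight k y)%:E),
        cvgn (series (dunkl_heat_term k f t x)),
        forall y : R, cvgn (series (dunkl_kernel_term k t x y)),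
        (@lebesgue_measure R).-integrable setT
          (fun y => (dunkl_kernel k t x y * f y * dunkl_weight k y)%:E)
      & dunkl_heat k f t x =
        \int[@lebesgue_measure R]_y
          (dunkl_kernel k t x y * f y * dunkl_weight k y)].
Proof.
move=> t x t0.
have [cK iK cH] := heat_kernel_representation k p t x f k_ge0 p_ge1 f_Lp t0.
split => //.
- by move=> n; exact: (integrable_dunkl_coef _ _ p).
- exact: cvgP cH.
- exact: cvg_lim cH.
Qed.
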